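(* Let $F$ be a field with $\operatorname{char} F\ne 2$, let $n\geq 2$, and let $J_{n+1}(f)$ be the simple Jordan algebra of a nondegenerate symmetric bilinear form $f$ on an $n$-dimensional vector space $V$ over $F$. If $n$ is even, then every Rota--Baxter operator on $J_{n+1}(f)$ of nonzero weight is splitting.
   Context: $J_{n+1}(f)=F\cdot 1\oplus V$ is the $(n+1)$-dimensional algebra with product $(\alpha\cdot 1+a)(\beta\cdot 1+b)=(\alpha\beta+f(a,b))\cdot 1+(\alpha b+\beta a)$ for $\alpha,\beta\in F$, $a,b\in V$. A linear operator $R\colon A\to A$ on an algebra $A$ over $F$ is a Rota--Baxter operator of weight $\Delta\in F$ if $R(x)R(y)=R(R(x)y+xR(y)+\Delta xy)$ for all $x,y\in A$. A Rota--Baxter operator $R$ of weight $\Delta$ on $A$ is called splitting if there are subalgebras $A_1,A_2$ of $A$ (possibly zero) such that $A=A_1\oplus A_2$ as vector spaces and $R(x_1+x_2)=-\Delta x_2$ for all $x_1\in A_1$, $x_2\in A_2$. *)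

(* Defs.v *)
From HB Require Import structures.
From mathcomp Require Import all_boot all_algebra.

Set Implicit Arguments.
Unset Strict Implicit.
Unset Printing Implicit Defensive.

Import GRing.Theory.
Local Open Scope ring_scope.

(* In the first three definitions an algebra over F is a finite-dimensional
   vector space A with a bilinear product mul; associativity, commutativity
   and the existence of a unit are not required. *)

Definition subalgebra (F : fieldType) (A : vectType F)
    (mul : {bilinear A -> A -> A}) (U : {vspace A}) : Prop :=
  {in U &, forall x y, mul x y \in U}.

Definition rota_baxter (F : fieldType) (A : vectType F)
    (mul : {bilinear A -> A -> A}) (Delta : F) (R : 'End(A)) : Prop :=
  forall x y : A,
    mul (R x) (R y) = R (mul (R x) y + mul x (R y) + Delta *: mul x y).

Definition splitting (F : fieldType) (A : vectType F)
    (mul : {bilinear A -> A -> A}) (Delta : F) (R : 'End(A)) : Prop :=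
  exists A1 A2 : {vspace A},
    [/\ subalgebra mul A1, subalgebra mul A2,
        directv (A1 + A2), (A1 + A2)%VS = fullv
      & {in A1 & A2, forall x1 x2, R (x1 + x2) = - Delta *: x2}].

Section JordanAlgebraOfForm.
Variables (F : fieldType) (V : vectType F) (f : {symmetric V}).

(* The pair (alpha, a) stands for alpha 1 + a in F 1 (+) V; F^o is F viewed as
   a vector space over itself. *)
Definition jordan_mul (x y : F^o * V) : F^o * V :=
  (x.1 * y.1 + f x.2 y.2, x.1 *: y.2 + y.1 *: x.2).

Fact jordan_mul_bilinear :
  bilinear_for (GRing.Scale.Law.clone _ _ *:%R _)
               (GRing.Scale.Law.clone _ _ *:%R _) jordan_mul.
Proof.
have scaleE (b c : F) : b *: (c : F^o) = b * c by [].
split=> u a x y; congr (_, _) => /=.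
- by rewrite linearPl !scaleE mulrDl mulrDr !mulrA addrACA.
- by rewrite scalerDl !scalerDr !scalerA [u.1 * a]mulrC addrACA.
- by rewrite linearPr !scaleE !mulrDr !(mulrCA u.1) addrACA.
- by rewrite scalerDl !scalerDr !scalerA [u.1 * a]mulrC addrACA.
Qed.
HB.instance Definition _ := bilinear_isBilinear.Build F
  (F^o * V)%type (F^o * V)%type (F^o * V)%type _ _ jordan_mul
  jordan_mul_bilinear.

End JordanAlgebraOfForm.

(* Main.v *)
Require Import Defs.
From HB Require Import structures.
From mathcomp Require Import all_boot all_algebra zify.

Import GRing.Theory.
Local Open Scope ring_scope.

(** The operator [S = R + Delta] is Rota-Baxter of weight [- Delta], so the
    images of [R] and [S] are subalgebras, and [R] is splitting as soon as
    [R S = 0]. The unit is never in both images: if [1 = R x = S y] then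
    [R y = R x * R y = R (y + x * S y) = R y + R x], so [1 = R x = 0].
    On a subalgebra of J_(n+1)(f) without the unit the quadratic norm vanishes;
    as n + 1 is odd, such a subalgebra has dimension at most n / 2. Hence if,
    say, 1 is not in the image of [S], the kernel of [S], of dimension at least
    n / 2 + 1, contains 1; from [S 1 = 0] and the Rota-Baxter identity one gets
    [S R = 0]. *)

Section RotaBaxter.
Set Implicit Arguments.
Unset Strict Implicit.
Variables (F : fieldType) (A : vectType F) (mul : {bilinear A -> A -> A}).
Implicit Types (Delta : F) (R : 'End(A)).

Lemma shiftE Delta R x : (R + Delta *: \1)%VF x = R x + Delta *: x.
Proof. by rewrite !lfun_simp. Qed.

Lemma shiftK Delta R : (R + Delta *: \1 + (- Delta) *: \1 = R)%VF.
Proof. by rewrite scaleNr addrK. Qed.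

(** With [shiftK], this makes R and S = R + Delta interchangeable: a fact proved for one operator
    transfers to the other. *)
Lemma rota_baxter_shift Delta R :
  rota_baxter mul Delta R -> rota_baxter mul (- Delta) (R + Delta *: \1)%VF.
Proof.
move=> RB x y.
have -> : mul ((R + Delta *: \1)%VF x) y + mul x ((R + Delta *: \1)%VF y)
    + - Delta *: mul x y = mul (R x) y + mul x (R y) + Delta *: mul x y.
  rewrite !shiftE linearDl linearDr linearZl_LR linearZr_LR /= scaleNr.
  by rewrite addrA addrK [RHS]addrAC.
rewrite !shiftE -RB linearDl !linearDr !linearZl_LR !linearZr_LR /=.
by rewrite !scalerDr !addrA.
Qed.

Lemma subalgebra_limg Delta R :
  rota_baxter mul Delta R -> subalgebra mul (limg R).
Proof.
by move=> RB _ _ /memv_imgP[x _ ->] /memv_imgP[y _ ->]; rewrite RB memv_img ?memvf.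
Qed.

(** When R x = R y = 0, the identity reduces to 0 = Delta R (x y). *)
Lemma subalgebra_lker Delta R :
  Delta != 0 -> rota_baxter mul Delta R -> subalgebra mul (lker R).
Proof.
move=> Delta0 RB x y; rewrite !memv_ker => /eqP Rx0 /eqP Ry0.
have /esym/eqP := RB x y.
by rewrite Rx0 Ry0 !(linear0l, linear0r) !add0r linearZ scaler_eq0 (negPf Delta0).
Qed.

(** The summands are ker R and ker S with S = R + Delta. They span because x = Delta^-1 (S x - R x),
    where R S = S R = 0 puts S x in ker R and R x in ker S. *)
Lemma splitting_of_comp0 Delta R :
    Delta != 0 -> rota_baxter mul Delta R ->
  (forall x, R (R x + Delta *: x) = 0) -> splitting mul Delta R.
Proof.
move=> Delta0 RB RS0; pose S := (R + Delta *: \1)%VF.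
have SE x : S x = R x + Delta *: x by exact: shiftE.
exists (lker R), (lker S).
have kerS x : x \in lker S -> R x = - Delta *: x.
  by rewrite memv_ker SE addr_eq0 scaleNr => /eqP.
split.
- exact: (subalgebra_lker Delta0 RB).
- by apply: subalgebra_lker (_ : - Delta != 0) (rota_baxter_shift RB); rewrite oppr_eq0.
- apply/directv_addP/eqP; rewrite -subv0; apply/subvP => x.
  rewrite memv_cap memv_ker memv0 => /andP[/eqP Rx0 /kerS].
  by rewrite Rx0 => /esym/eqP; rewrite scaler_eq0 oppr_eq0 (negPf Delta0).
- apply/eqP; rewrite eqEsubv subvf; apply/subvP => x _.
  have -> : x = Delta^-1 *: S x + - Delta^-1 *: R x.
    by rewrite SE scalerDr scalerA mulVf // scale1r scaleNr addrAC subrr add0r.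
  apply: memv_add; apply: memvZ; rewrite memv_ker SE ?RS0 //.
  by have := RS0 x; rewrite linearD linearZ => ->.
- move=> x1 x2; rewrite memv_ker => /eqP Rx1 /kerS Rx2.
  by rewrite linearD /= Rx1 Rx2 add0r.
Qed.

Section Unit.
Variable e : A.
Hypotheses (mul1x : forall x, mul e x = x) (mulx1 : forall x, mul x e = x).

Lemma splitting_of_ker_unit Delta R :
    Delta != 0 -> rota_baxter mul Delta R ->
  R e = 0 \/ (R + Delta *: \1)%VF e = 0 -> splitting mul Delta R.
Proof.
(* This is the Rota-Baxter identity at the pair (e, x). *)
have comp0 D (T : 'End(A)) :
    rota_baxter mul D T -> T e = 0 -> forall x, T (T x + D *: x) = 0.
  by move=> RB Te0 x; have := RB e x; rewrite Te0 !linear0l !mul1x add0r.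
move=> Delta0 RB kere; apply: splitting_of_comp0 => // x.
case: kere => [Re0 | Se0]; first exact: (comp0 _ _ RB Re0).
(* For S, of weight - Delta, this reads S (R x) = 0, and S commutes with R. *)
have := comp0 _ _ (rota_baxter_shift RB) Se0 x.
by rewrite -shiftE shiftK shiftE linearD linearZ.
Qed.

Lemma unit_notin_limgs Delta R :
    e != 0 -> rota_baxter mul Delta R ->
  ~~ ((e \in limg R) && (e \in limg (R + Delta *: \1)%VF)).
Proof.
move=> e0 RB; apply: contraNN e0 => /andP[/memv_imgP[x _ ex] /memv_imgP[y _ ey]].
have := RB x y.
rewrite -ex !mul1x -addrA -linearZ -linearDr -shiftE -ey mulx1 linearD /= -ex.
by rewrite -[LHS]addr0 => /addrI <-.
Qed.

End Unit.
End RotaBaxter.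

Section Isotropic.
Set Implicit Arguments.
Unset Strict Implicit.
Variables (F : fieldType) (eps : bool) (theta : {rmorphism F -> F}).
Variables (A : vectType F) (form : {hermitian A for eps & theta}).

(** Rank-nullity on U for the map [h] pairing u with a basis of W: its rank is at most dim W, and
    its kernel in U lies in W^perp. *)
Lemma dim_cap_orthov (U W : {vspace A}) :
  (\dim U <= \dim (U :&: orthov form W) + \dim W)%N.
Proof.
pose h (u : A) := \row_(i < \dim W) form u (vbasis W)`_i.
have h_lin : linear h.
  by move=> a u v; apply/rowP=> i; rewrite !mxE linearPl.
pose hL := GRing.isLinear.Build F A 'rV[F]_(\dim W) *:%R h h_lin.
pose g : {linear A -> 'rV[F]_(\dim W)} := HB.pack h hL.
rewrite -(limg_ker_dim (linfun g) U); apply: leq_add; last first.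
  by apply: leq_trans (dimvS (subvf _)) _; rewrite dimvf /dim /= mul1n.
apply/dimvS/capvS => //; apply/subvP => u.
rewrite memv_ker lfunE /= => /eqP/rowP hu0.
apply/mem_orthovP => w /coord_vbasis ->; rewrite linear_sumr big1 // => i _.
by have := hu0 i; rewrite !mxE linearZr /= => ->; rewrite mulr0.
Qed.

(* A complement W of U satisfies [U :&: W^perp = 0], as W^perp meets the
   isotropic U in the radical. *)
Lemma dim_isotropic (U : {vspace A}) :
  nondegenerate form -> (U <= orthov form U)%VS -> (2 * \dim U <= \dim {:A})%N.
Proof.
move=> /eqP rad0 isoU; have := dim_cap_orthov U U^C%VS.
have -> : (U :&: orthov form U^C)%VS = 0%VS.
  apply/eqP; rewrite -subv0 -rad0 -(addv_complf U) orthovD.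
  by rewrite (subv_trans (capvSl _ _) isoU) capvSr.
rewrite dimv0 add0n dimv_compl mul2n -addnn => leUC.
by rewrite -leq_subRL // dimvS ?subvf.
Qed.

End Isotropic.

Section JordanNorm.
Set Implicit Arguments.
Unset Strict Implicit.
Variables (F : fieldType) (V : vectType F) (f : {symmetric V}).

Lemma dim_jordan : \dim {:(F^o * V)%type} = (\dim {:V}).+1.
Proof. by rewrite !dimvf. Qed.

(** The symmetric form whose diagonal is the quadratic norm N(a 1 + v) = a^2 - f(v, v). *)
Definition norm_form (x y : F^o * V) : F := x.1 * y.1 - f x.2 y.2.

Fact norm_form_bilinear :
  bilinear_for (GRing.Scale.Law.clone _ _ *%R _)
               (GRing.Scale.Law.clone _ _ (idfun \; *%R) _) norm_form.
Proof.
have scaleE (b c : F) : b *: (c : F^o) = b * c by [].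
split=> u a x y; rewrite /norm_form /= scaleE.
- by rewrite linearPl mulrDl mulrBr mulrA opprD addrACA.
- by rewrite linearPr mulrDr mulrBr mulrCA opprD addrACA.
Qed.
HB.instance Definition _ := bilinear_isBilinear.Build F
  (F^o * V)%type (F^o * V)%type F _ _ norm_form norm_form_bilinear.

Fact norm_form_hermitian x y :
  norm_form x y = (-1) ^+ false * idfun (norm_form y x).
Proof. by rewrite /norm_form [f _ _]hermC !mul1r mulrC. Qed.
HB.instance Definition _ := isHermitianSesquilinear.Build F
  (F^o * V)%type false idfun norm_form norm_form_hermitian.

(** Pairing with (1, 0) isolates the scalar part; pairing with (0, w) leaves - f v w. *)
Lemma norm_form_nondegenerate : nondegenerate f -> nondegenerate norm_form.
Proof.
move=> /eqP radf; rewrite /nondegenerate -subv0; apply/subvP => -[a v] /mem_orthovP xP.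
have a0 : a = 0.
  by have := xP (1, 0) (memvf _); rewrite /= /norm_form /= mulr1 linear0r subr0.
suff v0 : v = 0 by rewrite memv0 a0 v0.
apply/eqP; rewrite -memv0 -radf; apply/mem_orthovP => w _.
have := xP (0, w) (memvf _); rewrite /= /norm_form /= mulr0 add0r.
by move/eqP; rewrite oppr_eq0 => /eqP.
Qed.

Lemma jordan_mul1x (x : F^o * V) : jordan_mul f (1, 0) x = x.
Proof.
case: x => a v; rewrite /jordan_mul /= mul1r linear0l addr0.
by rewrite scale1r scaler0 addr0.
Qed.

Lemma jordan_mulx1 (x : F^o * V) : jordan_mul f x (1, 0) = x.
Proof.
case: x => a v; rewrite /jordan_mul /= mulr1 linear0r addr0.
by rewrite scale1r scaler0 add0r.
Qed.

(* Every x satisfies [x ^ 2 = 2 t(x) x - N(x) 1], hence [N(x) 1] lies in any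
   subalgebra containing x. *)
Lemma subalgebra_isotropic (U : {vspace F^o * V}) :
    2%N \notin [pchar F] -> subalgebra (jordan_mul f) U -> (1, 0) \notin U ->
  (U <= orthov norm_form U)%VS.
Proof.
move=> charF algU U1.
have N0 x : x \in U -> norm_form x x = 0.
  move=> Ux; apply/eqP; apply: contraNT U1 => Nx.
  rewrite -[(1, 0)](scalerK Nx) memvZ //.
  suff -> : norm_form x x *: (1, 0) = (x.1 + x.1) *: x - jordan_mul f x x.
    by rewrite memvB ?algU // memvZ.
  case: x {Ux Nx} => a v; congr (_, _) => /=.
    by rewrite /norm_form /= /GRing.scale /= mulr1 mulrDl opprD addrA addrK.
  by rewrite scaler0 scalerDl subrr.
apply/orthovP => x y Ux Uy; apply/eqP.
(* Polarization: N(x + y) = 0 yields 2 [norm_form x y] = 0, and 2 is invertible. *)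
have := N0 _ (memvD Ux Uy).
rewrite hnormD /= !N0 // add0r add0r mul1r -mulr2n -mulr_natl => /eqP.
by rewrite mulf_eq0 => /orP[two0|//]; move: charF; rewrite inE /= two0.
Qed.

Lemma dim_subalgebra_without_unit (U : {vspace F^o * V}) :
    2%N \notin [pchar F] -> nondegenerate f -> subalgebra (jordan_mul f) U ->
  (1, 0) \notin U -> (2 * \dim U <= (\dim {:V}).+1)%N.
Proof.
move=> charF fN algU U1.
have := dim_isotropic (norm_form_nondegenerate fN) (subalgebra_isotropic charF algU U1).
by rewrite dim_jordan.
Qed.

(** Image and kernel are subalgebras whose dimensions sum to n + 1. If both missed the unit, each
    dimension would be at most (n + 1) / 2, hence equal to it, and n would be odd. *)
Lemma unit_in_limg_or_lker (Delta : F) (R : 'End((F^o * V)%type)) :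
    2%N \notin [pchar F] -> nondegenerate f -> ~~ odd (\dim {:V}) ->
    Delta != 0 -> rota_baxter (jordan_mul f) Delta R ->
  (1, 0) \notin limg R -> R (1, 0) = 0.
Proof.
move=> charF fN evenV Delta0 RB img1; apply/eqP; rewrite -memv_ker.
apply: contraLR evenV => ker1; rewrite negbK.
have dimI := dim_subalgebra_without_unit charF fN (subalgebra_limg RB) img1.
have dimK := dim_subalgebra_without_unit charF fN (subalgebra_lker Delta0 RB) ker1.
have := limg_ker_dim R fullv; rewrite capfv dim_jordan.
have half_sum (a b d : nat) :
    (2 * a <= d.+1)%N -> (2 * b <= d.+1)%N -> (b + a = d.+1)%N -> odd d by lia.
exact: half_sum dimI dimK.
Qed.

End JordanNorm.

Theorem theorem2 (F : fieldType) (V : vectType F) (n : nat) (f : {symmetric V})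
    (charF : 2%N \notin [pchar F]) (n_ge2 : (2 <= n)%N) (dimV : \dim {:V} = n)
    (f_nondeg : nondegenerate f) (n_even : ~~ odd n)
    (Delta : F) (Delta_neq0 : Delta != 0)
    (R : 'End((F^o * V)%type)) :
  rota_baxter (jordan_mul f) Delta R -> splitting (jordan_mul f) Delta R.
Proof.
move=> RB; rewrite -dimV in n_even.
have mul1x := jordan_mul1x f; have mulx1 := jordan_mulx1 f.
have one0 : ((1, 0) : (F^o * V)%type) != 0 by rewrite -pair_eqE /= oner_eq0.
apply: (splitting_of_ker_unit mul1x) => //.
have := unit_notin_limgs mul1x mulx1 one0 RB.
(* Whichever of R and S misses the unit in its image must kill it. *)
rewrite negb_and => /orP[imR | imS]; [left | right].
  exact: unit_in_limg_or_lker RB imR.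
by apply: unit_in_limg_or_lker (rota_baxter_shift RB) imS; rewrite ?oppr_eq0.
Qed.
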